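(* Let $\mathcal A\subset\mathbb R^d$ be a point configuration and let $k\ge 1$. Every $k$-split of $\mathcal A$ is a regular subdivision of $\mathcal A$.
   Context: A point configuration is a finite multiset $\mathcal A\subset\mathbb R^d$ (points may be repeated) whose affine hull is $\mathbb R^d$. A face of $\mathcal A$ is a subconfiguration $\mathcal A\cap H$ where $H$ is a supporting hyperplane of $\operatorname{conv}\mathcal A$ (together with $\mathcal A$ itself). A subdivision $\Sigma$ of $\mathcal A$ is a collection of subconfigurations of $\mathcal A$ (its faces) such that: (SD1) if $F\in\Sigma$ and $\bar F$ is a face of $F$ then $\bar F\in\Sigma$; (SD2) $\operatorname{conv}\mathcal A=\bigcup_{F\in\Sigma}\operatorname{conv}F$; (SD3) for distinct $F,\bar F\in\Sigma$, $\operatorname{relint}\operatorname{conv}F\cap\operatorname{relint}\operatorname{conv}\bar F=\emptyset$. The trivial subdivision consists of all faces of $\mathcal A$. A subdivision $\Sigma$ refines $\Sigma'$ (and $\Sigma'$ coarsens $\Sigma$) if every face of $\Sigma$ is contained in some face of $\Sigma'$. A face of $\Sigma$ is interior if it is not contained in the boundary of $\operatorname{conv}\mathcal A$. A subdivision is coarsest if it is non-trivial and the only subdivisions coarsening it are itself and the trivial subdivision. A $k$-split of $\mathcal A$ is a coarsest subdivision with exactly $k$ maximal faces that has an interior face $F$ with $\dim\operatorname{conv}F=d-(k-1)$. For a weight function $w:\mathcal A\to\mathbb R$, the regular subdivision $\Sigma_w(\mathcal A)$ consists of the sets $\{b\in\mathcal A:(w(b),b)\in F\}$ for the lower (i.e.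 bounded) faces $F$ of $\operatorname{conv}\{(w(a),a):a\in\mathcal A\}+\mathbb R_{\ge0}(1,0,\dots,0)\subset\mathbb R\times\mathbb R^d$; a subdivision is regular if it equals $\Sigma_w(\mathcal A)$ for some $w$. *)

(* Defs.v *)
From HB Require Import structures.
From mathcomp Require Import all_boot all_order all_algebra.
From mathcomp Require Import all_classical all_reals all_analysis.

Set Implicit Arguments.
Unset Strict Implicit.
Unset Printing Implicit Defensive.

Import Order.TTheory GRing.Theory Num.Theory.
Import numFieldNormedType.Exports.

Local Open Scope classical_set_scope.
Local Open Scope ring_scope.

(* A finite multiset of points of R^d is a family [a : I -> 'rV[R]_d] indexed
   by a finType; a subconfiguration is a set of labels [F : {set I}], so equal
   points with different labels are distinct elements of the configuration. *)

Section ConvexGeometry.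
Variables (R : realType) (d : nat).
Implicit Types (C : set 'rV[R]_d) (c : 'cV[R]_d) (b : R).

Definition aff_hull C : set 'rV[R]_d :=
  [set x | exists (m : nat) (p : 'I_m -> 'rV[R]_d) (l : 'I_m -> R),
     [/\ forall i, C (p i), \sum_i l i = 1 & x = \sum_i l i *: p i]].

Definition relint C : set 'rV[R]_d :=
  [set x | C x /\ \forall y \near x, aff_hull C y -> C y].

Definition boundary C : set 'rV[R]_d := closure C `\` interior C.

Definition hyperplane c b : set 'rV[R]_d := [set x | (x *m c) 0 0 = b].

Definition supporting_hyperplane c b C : Prop :=
  [/\ c != 0, forall x, C x -> b <= (x *m c) 0 0
    & C `&` hyperplane c b !=set0].

Definition convex_face C (F : set 'rV[R]_d) : Prop :=
  F = C \/ exists c b, supporting_hyperplane c b C /\ F = C `&` hyperplane c b.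

End ConvexGeometry.

Section PointConfigurations.
Variables (R : realType) (I : finType).

Definition conv d (a : I -> 'rV[R]_d) (F : {set I}) : set 'rV[R]_d :=
  [set x | exists l : I -> R,
     [/\ forall i, i \in F -> 0 <= l i,
         \sum_(i in F) l i = 1 & x = \sum_(i in F) l i *: a i]].

(* Dimension of the direction space of the affine hull of [conv a F]; this is
   [dim (conv a F)] for [F] nonempty, and 0 for [F] empty. *)
Definition dim_conv d (a : I -> 'rV[R]_d) (F : {set I}) : nat :=
  \dim <<[seq a i - a j | i <- enum F, j <- enum F]>>%VS.

Variables (d : nat) (a : I -> 'rV[R]_d).
Implicit Types (F G : {set I}) (Sigma : {set {set I}}).

Definition point_configuration : Prop := aff_hull (range a) = setT.

Definition config_face F G : Prop :=
  G = F \/ exists c b, supporting_hyperplane c b (conv a F) /\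
    forall i, (i \in G) <-> (i \in F /\ hyperplane c b (a i)).

(* Supporting hyperplanes meet the convex hull, so faces are nonempty. The
   empty subconfiguration is therefore excluded from subdivisions: (SD1)-(SD3)
   alone would allow it to be added to or removed from any subdivision. *)
Definition subdivision Sigma : Prop :=
  [/\ finset.set0 \notin Sigma,
      forall F G, F \in Sigma -> config_face F G -> G \in Sigma,
      conv a [set: I]%SET = \bigcup_(F in [set` Sigma]) conv a F
    & forall F G, F \in Sigma -> G \in Sigma -> F != G ->
        relint (conv a F) `&` relint (conv a G) = set0].

Definition trivial_subdivision Sigma : Prop :=
  forall G, (G \in Sigma) <-> config_face [set: I]%SET G.

Definition refines Sigma Sigma' : Prop :=
  forall F, F \in Sigma -> exists2 G, G \in Sigma' & F \subset G.

Definition interior_face Sigma F : Prop :=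
  F \in Sigma /\ ~ (conv a F `<=` boundary (conv a [set: I]%SET)).

Definition maximal_faces Sigma : {set {set I}} :=
  [set F | maxset [in Sigma] F]%SET.

Definition coarsest Sigma : Prop :=
  [/\ subdivision Sigma, ~ trivial_subdivision Sigma
    & forall Sigma', subdivision Sigma' -> refines Sigma Sigma' ->
        Sigma' = Sigma \/ trivial_subdivision Sigma'].

(* [dim F = d - (k - 1)] is written additively to avoid truncated
   subtraction when [k > d + 1]. *)
Definition ksplit (k : nat) Sigma : Prop :=
  [/\ coarsest Sigma, #|maximal_faces Sigma| = k
    & exists2 F, interior_face Sigma F & (dim_conv a F + (k - 1) = d)%N].

(* R x R^d is represented by row vectors of length 1 + d, height first. *)
Definition lift_point (w : I -> R) (i : I) : 'rV[R]_(1 + d) :=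
  row_mx (w i)%:M (a i).

Definition lifted_polyhedron (w : I -> R) : set 'rV[R]_(1 + d) :=
  [set x | exists (y : 'rV[R]_(1 + d)) (t : R),
     [/\ conv (lift_point w) [set: I]%SET y, 0 <= t
       & x = y + t *: row_mx 1%:M 0]].

Definition lower_face (w : I -> R) (P : set 'rV[R]_(1 + d)) : Prop :=
  convex_face (lifted_polyhedron w) P /\ bounded_set P.

Definition is_regular_subdivision (w : I -> R) Sigma : Prop :=
  forall G, (G \in Sigma) <->
    exists2 P, lower_face w P & forall i, (i \in G) <-> P (lift_point w i).

Definition regular_subdivision Sigma : Prop :=
  exists w, is_regular_subdivision w Sigma.

End PointConfigurations.

(* Main.v *)
Require Import Defs.
From mathcomp Require Import all_boot all_order all_algebra.
From mathcomp Require Import all_classical all_reals all_analysis.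
From mathcomp Require Import zify ring lra.

(** Let [x0] be the barycenter of the interior face [F] of dimension [d-(k-1)].
    The maximal cells containing [F] span at [x0] a complete fan whose cones have
    lineality space [V], the direction space of [F].  By Gordan's theorem, any two
    of these cells are separated by a functional vanishing exactly on their common
    points, and each cone is cut out by the functionals separating it from the
    others; since their common kernel is [V], there are at least [d - dim V = k-1]
    of them.  Hence all [k] maximal cells contain [F], each family of [k-1]
    separating functionals is independent, and the fan is that of a simplex.  A
    convex function linear exactly on its cones is obtained from the ray opposite
    to one cone.  Its values at the points, increased at the points that belong to
    no cell, are weights inducing the subdivision. *)

Set Implicit Arguments.
Unset Strict Implicit.
Unset Printing Implicit Defensive.

Import Order.TTheory GRing.Theory Num.Theory.
Import numFieldNormedType.Exports.
Import Defs.

Local Open Scope classical_set_scope.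
Local Open Scope ring_scope.

(** * The pairing of row vectors with linear functionals *)

Section Dot.
Variables (R : realType) (d : nat).
Implicit Types (v : 'rV[R]_d) (c : 'cV[R]_d).

Definition dot v c : R := (v *m c) 0 0.

Lemma dotE v c : (v *m c) 0 0 = dot v c. Proof. by []. Qed.

Lemma dotDl v v' c : dot (v + v') c = dot v c + dot v' c.
Proof. by rewrite /dot mulmxDl mxE. Qed.

Lemma dotNl v c : dot (- v) c = - dot v c.
Proof. by rewrite /dot mulNmx mxE. Qed.

Lemma dotBl v v' c : dot (v - v') c = dot v c - dot v' c.
Proof. by rewrite dotDl dotNl. Qed.

Lemma dotZl k v c : dot (k *: v) c = k * dot v c.
Proof. by rewrite /dot -scalemxAl mxE. Qed.

Lemma dot0l c : dot 0 c = 0.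
Proof. by rewrite /dot mul0mx mxE. Qed.

Lemma dot_suml (J : finType) (P : pred J) (f : J -> 'rV[R]_d) c :
  dot (\sum_(j | P j) f j) c = \sum_(j | P j) dot (f j) c.
Proof. by rewrite /dot mulmx_suml summxE. Qed.

Lemma dotDr v c c' : dot v (c + c') = dot v c + dot v c'.
Proof. by rewrite /dot mulmxDr mxE. Qed.

Lemma dotNr v c : dot v (- c) = - dot v c.
Proof. by rewrite /dot mulmxN mxE. Qed.

Lemma dotBr v c c' : dot v (c - c') = dot v c - dot v c'.
Proof. by rewrite dotDr dotNr. Qed.

Lemma dotZr k v c : dot v (k *: c) = k * dot v c.
Proof. by rewrite /dot -scalemxAr mxE. Qed.

Lemma dot0r v : dot v 0 = 0.
Proof. by rewrite /dot mulmx0 mxE. Qed.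

Lemma dot_sumr (J : finType) (P : pred J) v (f : J -> 'cV[R]_d) :
  dot v (\sum_(j | P j) f j) = \sum_(j | P j) dot v (f j).
Proof. by rewrite /dot mulmx_sumr summxE. Qed.

Lemma dot_delta v j : dot v (delta_mx j 0) = v 0 j.
Proof. by rewrite /dot -colE mxE. Qed.

End Dot.

(** * Theorems of the alternative of Farkas and Gordan *)

Section Farkas.
Variables (R : realType) (d : nat) (I : finType).
Implicit Types (S T : {set I}) (q : I -> 'rV[R]_d) (b : 'rV[R]_d).

(* Bartl's induction: if dropping the generator [q s] breaks the hypothesis at
   some [c0], then projecting along [c0] onto the kernel of [q s] restores it. *)
Lemma farkas S q b :
    (forall c, (forall i, i \in S -> 0 <= dot (q i) c) -> 0 <= dot b c) ->
  exists2 mu : I -> R, forall i, 0 <= mu i & b = \sum_(i in S) mu i *: q i.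
Proof.
have [n] := ubnP #|S|; elim: n => // n IHn in S q b *; rewrite ltnS => Sn Hb.
have [S0|[s sS]] := set_0Vmem S.
  exists (fun=> 0) => //; rewrite S0 big_set0; apply/rowP => j; rewrite mxE.
  have Hc c : 0 <= dot b c by apply: Hb => i; rewrite S0 inE.
  have := Hc (delta_mx j 0); have := Hc (- delta_mx j 0).
  by rewrite dotNr dot_delta; lra.
have Sn' : (#|S :\ s| < n)%N.
  by apply: leq_trans Sn; rewrite [ltnRHS](cardsD1 s) sS.
have splitS (mu : I -> R) (r : I -> 'rV[R]_d) :
    \sum_(i in S) mu i *: r i = mu s *: r s + \sum_(i in S :\ s) mu i *: r i.
  rewrite (bigD1 s) //=; congr (_ + _); apply: eq_bigl => i.
  by rewrite !inE andbC.
have [Hb'|Nb'] := pselect (forall c, (forall i, i \in S :\ s ->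
    0 <= dot (q i) c) -> 0 <= dot b c).
  have [mu mu0 ->] := IHn _ _ _ Sn' Hb'.
  exists (fun i => if i == s then 0 else mu i) => [i|]; first by case: ifP.
  rewrite splitS eqxx scale0r add0r; apply: eq_bigr => i.
  by rewrite !inE => /andP[/negPf ->].
have {Nb'} [c [Hc bc]] : exists c, (forall i, i \in S :\ s ->
    0 <= dot (q i) c) /\ dot b c < 0.
  apply: contra_notP Nb' => Hn c Hc; rewrite leNgt; apply/negP => bc.
  by apply: Hn; exists c.
have sc : dot (q s) c < 0.
  rewrite ltNge; apply/negP => sc; have: 0 <= dot b c; last by lra.
  by apply: Hb => i iS; have [->|si] := eqVneq i s; [|apply: Hc; rewrite !inE si].
pose t := - (dot (q s) c)^-1; pose c0 : 'cV[R]_d := t *: c.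
have t0 : 0 < t by rewrite oppr_gt0 invr_lt0.
have sc0 : dot (q s) c0 = -1 by rewrite dotZr /t mulNr mulVf // lt_eqF.
have Hc0 i : i \in S :\ s -> 0 <= dot (q i) c0.
  by move=> /Hc ?; rewrite dotZr mulr_ge0 // ltW.
have bc0 : dot b c0 < 0 by rewrite dotZr nmulr_llt0.
move: c0 sc0 Hc0 bc0 => c0 sc0 Hc0 bc0 {t t0}.
(* Since [dot (q s) c0] is -1, [pr] projects along [q s] onto the kernel of [c0]; it kills [q s], so
   this generator drops out. *)
pose pr (v : 'rV[R]_d) : 'rV[R]_d := v + dot v c0 *: q s.
have [|mu mu0 Hmu] := IHn (S :\ s) (pr \o q) (pr b) Sn'.
  move=> x Hx; have prE v : dot (pr v) x = dot v (x + dot (q s) x *: c0).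
    by rewrite /pr dotDl dotZl dotDr dotZr [_ * dot v c0]mulrC.
  rewrite prE; apply: Hb => i iS; have [->|si] := eqVneq i s.
    by rewrite dotDr dotZr sc0 mulrN1 subrr.
  by rewrite -prE; apply: Hx; rewrite !inE si.
(* The coefficient of [q s] comes from solving [pr b = \sum mu i *: pr (q i)] for [b]; it is
   nonnegative because [dot b c0 < 0]. *)
exists (fun i => if i == s then
    \sum_(i in S :\ s) mu i * dot (q i) c0 - dot b c0 else mu i) => [i|].
  case: ifP => // _; rewrite subr_ge0 (le_trans (ltW bc0)) // sumr_ge0 // => j jS.
  by rewrite mulr_ge0 ?Hc0.
rewrite splitS eqxx (eq_bigr (fun i => mu i *: q i)); last first.
  by move=> i; rewrite !inE => /andP[/negPf ->].
move: Hmu; rewrite /pr /= => /(congr1 (fun v => v - dot b c0 *: q s)).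
rewrite addrK => {1}->; under eq_bigr do rewrite scalerDr scalerA.
by rewrite big_split /= -scaler_suml scalerBl -addrA [RHS]addrC.
Qed.

(** For [t] in [T], Farkas applied to [- q t] gives a relation with positive coefficient at [t],
    unless a functional nonnegative on [S] is positive at [q t]. Without relations, the sum of these
    functionals over [T] is strict on all of [T]. *)
Lemma gordan S T q : T \subset S ->
  (exists c, (forall i, i \in S -> 0 <= dot (q i) c) /\
             (forall i, i \in T -> 0 < dot (q i) c)) \/
  (exists2 mu : I -> R, forall i, 0 <= mu i &
     (exists2 t, t \in T & 0 < mu t) /\ \sum_(i in S) mu i *: q i = 0).
Proof.
move=> /fintype.subsetP TS.
have [Hmu|Nmu] := pselect (exists2 mu : I -> R, forall i, 0 <= mu i &
  (exists2 t, t \in T & 0 < mu t) /\ \sum_(i in S) mu i *: q i = 0).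
  by right.
left; have Hc t : exists c, t \in T ->
    (forall i, i \in S -> 0 <= dot (q i) c) /\ 0 < dot (q t) c.
  apply: contra_notP Nmu => Nc.
  have tT : t \in T by apply/negPn/negP => tT; apply: Nc; exists 0; rewrite (negPf tT).
  have [|mu mu0 Hmu] := @farkas S q (- q t).
    move=> c Sc; rewrite leNgt; apply/negP; rewrite dotNl oppr_lt0 => tc.
    by apply: Nc; exists c.
  exists (fun i => mu i + (i == t)%:R) => [i|]; first by rewrite addr_ge0.
  split; first by exists t; rewrite // eqxx ltr_pwDr.
  under eq_bigr do rewrite scalerDl; rewrite big_split /= -Hmu.
  rewrite (bigD1 t) ?TS//= eqxx scale1r big1 ?addr0 ?addNr// => i /andP[_].
  by move=> /negPf ->; rewrite scale0r.
have [c {}Hc] := choice Hc.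
exists (\sum_(t in T) c t); split => i iS; rewrite dot_sumr.
  by apply: sumr_ge0 => t /Hc[+ _]; apply.
rewrite (bigD1 i) //= ltr_pwDl ?(Hc i iS).2 //; apply: sumr_ge0 => t /andP[/Hc[+ _] _].
by apply; apply: TS.
Qed.

End Farkas.

(** * Convex combinations and the face carrying a point *)

Section Configuration.
Variables (R : realType) (d : nat) (I : finType) (a : I -> 'rV[R]_d).
Implicit Types (F G H : {set I}) (x : 'rV[R]_d) (c : 'cV[R]_d).

(** The relative interior of [conv a H] in terms of coefficients, which keeps the labels visible. *)
Definition pos_comb H x := exists l : I -> R,
  [/\ forall i, i \in H -> 0 < l i, \sum_(i in H) l i = 1
    & x = \sum_(i in H) l i *: a i].

Lemma sum_supp (V : nmodType) F G (f : I -> V) : F \subset G ->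
  \sum_(i in G) (if i \in F then f i else 0) = \sum_(i in F) f i.
Proof.
move=> /fintype.subsetP FG; rewrite -big_mkcondr /=; apply: eq_bigl => i.
by rewrite andb_idl // => /FG.
Qed.

Lemma sum_suppZ F G (l : I -> R) (p : I -> 'rV[R]_d) : F \subset G ->
  \sum_(i in G) (if i \in F then l i else 0) *: p i = \sum_(i in F) l i *: p i.
Proof.
move=> FG; rewrite -(sum_supp _ FG); apply: eq_bigr => i _.
by case: ifP => // _; rewrite scale0r.
Qed.

Lemma pos_comb_conv H x : pos_comb H x -> conv a H x.
Proof. by case=> l [l0 l1 ->]; exists l; split=> // i /l0/ltW. Qed.

Lemma conv_sub F G : F \subset G -> conv a F `<=` conv a G.
Proof.
move=> FG _ [l [l0 l1 ->]]; exists (fun i => if i \in F then l i else 0).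
by split; rewrite ?sum_supp ?sum_suppZ // => i _; case: ifP => // /l0.
Qed.

Lemma sum_affine H (l : I -> R) x : \sum_(i in H) l i = 1 ->
  \sum_(i in H) l i *: (a i - x) = \sum_(i in H) l i *: a i - x.
Proof.
move=> l1; under eq_bigr do rewrite scalerBr.
by rewrite sumrB -scaler_suml l1 scale1r.
Qed.

Lemma conv_ge H c b x : conv a H x -> (forall i, i \in H -> b <= dot (a i) c) ->
  b <= dot x c.
Proof.
move=> [l [l0 l1 ->]] Hb; rewrite dot_suml -[b]mul1r -l1 mulr_suml.
by apply: ler_sum => i iH; rewrite dotZl ler_wpM2l ?Hb ?l0.
Qed.

Lemma conv_mem H i : i \in H -> conv a H (a i).
Proof.
move=> iH; exists (fun j => (j == i)%:R); split => [j _||].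
- exact: ler0n.
- rewrite (bigD1 i) //= eqxx big1 ?addr0// => j /andP[_ /negPf ->] //.
- rewrite (bigD1 i) //= eqxx scale1r big1 ?addr0// => j /andP[_ /negPf ->].
  by rewrite scale0r.
Qed.

(** Turns the second alternative of Gordan's theorem into a convex representation of [x]: the total
    mass is positive because of [t], and one divides by it. *)
Lemma conv_of_relation G x (mu : I -> R) t : (forall i, 0 <= mu i) -> t \in G ->
    0 < mu t -> \sum_(i in G) mu i *: (a i - x) = 0 ->
  exists l : I -> R, [/\ forall i, i \in G -> 0 <= l i, \sum_(i in G) l i = 1,
    x = \sum_(i in G) l i *: a i & 0 < l t].
Proof.
move=> mu0 tG mut Hmu; pose m := \sum_(i in G) mu i.
have m0 : 0 < m.
  by rewrite /m (bigD1 t) //= ltr_pwDl // sumr_ge0.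
have l1 : \sum_(i in G) m^-1 * mu i = 1 by rewrite -mulr_sumr mulVf ?gt_eqF.
exists (fun i => m^-1 * mu i); split => //.
- by move=> i _; rewrite mulr_ge0 // invr_ge0 ltW.
- apply/esym/eqP; rewrite -subr_eq0 -sum_affine //.
  under eq_bigr do rewrite -scalerA.
  by rewrite -scaler_sumr Hmu scaler0.
- by rewrite mulr_gt0 // invr_gt0.
Qed.

(** [H] collects the labels charged by some convex representation of [x]. A Gordan relation charging
    a label outside [H] would put that label into [H]; hence some functional is minimal over [G]
    exactly on [H]. *)
Lemma carrier_face G x : conv a G x -> exists H,
  [/\ config_face a G H, H \subset G, pos_comb H x &
      forall l : I -> R, (forall i, i \in G -> 0 <= l i) ->
        \sum_(i in G) l i = 1 -> x = \sum_(i in G) l i *: a i ->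
        forall t, t \in G -> 0 < l t -> t \in H].
Proof.
move=> Gx; pose P t (l : I -> R) := [/\ forall i, i \in G -> 0 <= l i,
  \sum_(i in G) l i = 1, x = \sum_(i in G) l i *: a i & 0 < l t].
pose H := [set t in G | `[< exists l, P t l >]]%SET.
have HG : H \subset G by apply/fintype.subsetP => t; rewrite inE => /andP[].
have HP t l : t \in G -> P t l -> t \in H.
  by move=> tG Pl; rewrite inE tG; apply/asboolP; exists l.
have posH : pos_comb H x.
  have [t tH] : exists t, t \in H.
    case: Gx => l [l0 l1 xl]; apply: contrapT => NH.
    have: \sum_(i in G) l i <= 0; last by rewrite l1 ler10.
    apply: sumr_le0 => t tG; rewrite leNgt; apply/negP => lt.
    by apply: NH; exists t; apply: (HP t l).
  have /choice[l Hl] s : exists l, s \in H -> P s l.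
    have [|sH] := boolP (s \in H); last by exists (fun=> 0).
    by rewrite inE => /andP[_ /asboolP[l Pl]]; exists l.
  have H0 : 0 < #|H|%:R :> R by rewrite ltr0n; apply/card_gt0P; exists t.
  (* The average of representations [l s], each charging its own [s], is positive on all of [H]. *)
  pose L i := #|H|%:R^-1 * \sum_(s in H) l s i.
  have Lge0 i : i \in G -> 0 <= L i.
    move=> iG; rewrite mulr_ge0 ?invr_ge0 ?(ltW H0) // sumr_ge0 // => s sH.
    by case: (Hl s sH) => + _ _ _; apply.
  have LP i : i \in G -> i \notin H -> L i = 0.
    move=> iG iH; rewrite /L big1 ?mulr0 // => s sH.
    case: (Hl s sH) => l0 l1 xl _; apply/eqP; rewrite eq_le l0 // andbT leNgt.
    by apply: contra iH => li; apply: (HP i (l s)).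
  have LE i : i \in G -> L i = if i \in H then L i else 0.
    by move=> iG; case: ifPn => // /LP ->.
  exists L; split.
  - move=> i iH; rewrite mulr_gt0 ?invr_gt0 // (bigD1 i) //= ltr_pwDl //.
      by case: (Hl i iH).
    apply: sumr_ge0 => s /andP[/Hl[l0 _ _ _] _].
    by apply: l0; apply: (fintype.subsetP HG).
  - rewrite -(sum_supp _ HG) -(eq_bigr _ LE) -mulr_sumr exchange_big /=.
    rewrite (eq_bigr (fun=> 1)) => [|s /Hl[]//].
    by rewrite sumr_const mulVf ?gt_eqF.
  - have -> : \sum_(i in H) L i *: a i = \sum_(i in G) L i *: a i.
      by rewrite -(sum_suppZ _ _ HG); apply: eq_bigr => i /LE <-.
    rewrite /L; under [RHS]eq_bigr do rewrite -scalerA scaler_suml.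
    rewrite -scaler_sumr exchange_big /= (eq_bigr (fun=> x)) => [|s /Hl[]//].
    by rewrite sumr_const -[x *+ _]scaler_nat scalerA mulVf ?gt_eqF ?scale1r.
exists H; split=> //; last by move=> l l0 l1 xl t tG lt; apply: (HP t l).
have [|[c [cG cT]]|[mu mu0 [[t]]]] := @gordan R d I G (G :\: H)%SET (fun i => a i - x).
- exact: finset.subsetDl.
- have [GH|NGH] := eqVneq H G; first by left.
  right; exists c, (dot x c).
  have cx i : i \in G -> dot x c <= dot (a i) c.
    by move=> /cG; rewrite dotBl subr_ge0.
  split; first split.
  + have /fintype.subsetPn[t tG tH] : ~~ (G \subset H).
      by apply: contra NGH => GH; rewrite finset.eqEsubset HG.
    apply/eqP => c0; have := cT t; rewrite inE tG tH c0 dot0r ltxx.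
    by move=> /(_ isT).
  + by move=> y Gy; apply: conv_ge cx.
  + by exists x; split.
  case: posH => l [l0 l1 xl] i; split => [iH|[iG]].
    have iG := fintype.subsetP HG _ iH; split=> //.
    have /psumr_eq0P : forall j, j \in H -> 0 <= l j * dot (a j - x) c.
      move=> j jH; rewrite mulr_ge0 ?cG ?(ltW (l0 j jH)) //.
      exact: (fintype.subsetP HG).
    have -> : \sum_(j in H) l j * dot (a j - x) c = 0.
      under eq_bigr do rewrite -dotZl.
      by rewrite -dot_suml sum_affine // -xl subrr dot0l.
    move=> /(_ erefl i iH)/eqP; rewrite mulf_eq0 gt_eqF ?l0 //= dotBl subr_eq0.
    by move=> /eqP.
  rewrite /hyperplane /= dotE => ixc; apply: contraPT ixc => iH.
  have := cT i; rewrite inE iH iG => /(_ isT); rewrite dotBl subr_gt0 => h.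
  by apply/eqP; rewrite gt_eqF.
- rewrite inE => /andP[tH tG] mut Hmu.
  have [l [l0 l1 xl lt]] := conv_of_relation mu0 tG mut Hmu.
  by case/negP: tH; apply: (HP t l).
Qed.

End Configuration.

(** * Relative interiors, barycenters and small displacements *)

Section RelativeInterior.
Variables (R : realType) (d : nat) (I : finType) (a : I -> 'rV[R]_d).
Implicit Types (F G H : {set I}) (x v : 'rV[R]_d) (c : 'cV[R]_d).

(** A pseudoinverse selects coefficients that depend linearly on the vector, so small vectors get
    small coefficients. *)
Lemma span_coef H (p : I -> 'rV[R]_d) : exists K : I -> 'cV[R]_d,
  forall tau : I -> R, let v := \sum_(i in H) tau i *: p i in
    v = \sum_(i in H) dot v (K i) *: p i.
Proof.
pose p' i := if i \in H then p i else 0.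
pose A := \matrix_(j < #|I|) p' (enum_val j).
have rowA (u : 'rV[R]_#|I|) :
    u *m A = \sum_(i in H) u 0 (enum_rank i) *: p i.
  rewrite mulmx_sum_row (reindex enum_rank) /=; last exact/onW_bij/enum_rank_bij.
  rewrite (bigID (mem H)) /= [X in _ + X]big1 => [|i /negPf iH]; last first.
    by rewrite rowK enum_rankK /p' iH scaler0.
  by rewrite addr0; apply: eq_bigr => i iH; rewrite rowK enum_rankK /p' iH.
exists (fun i => col (enum_rank i) (pinvmx A)) => tau v.
have vA : (v <= A)%MS.
  apply/submxP; exists (\row_j tau (enum_val j)); rewrite rowA.
  by apply: eq_bigr => i _; rewrite mxE enum_rankK.
rewrite -[LHS](mulmxKpV vA) rowA; apply: eq_bigr => i _; congr (_ *: _).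
by rewrite /dot [LHS]mxE [RHS]mxE; apply: eq_bigr => j _; rewrite [in RHS]mxE.
Qed.

Lemma mx_entry_le_norm m n (M : 'M[R]_(m, n)) i j : `|M i j| <= `|M|.
Proof.
rewrite /Num.norm /= mx_normrE.
exact: (le_bigmax 0 (fun ij : 'I_m * 'I_n => `|M ij.1 ij.2|) (i, j)).
Qed.

Lemma dot_norm v c : `|dot v c| <= `|v| * \sum_j `|c j 0|.
Proof.
rewrite /dot mxE (le_trans (ler_norm_sum _ _ _)) // mulr_sumr ler_sum // => j _.
by rewrite normrM ler_wpM2r // mx_entry_le_norm.
Qed.

Lemma near_dot x c e : 0 < e -> \forall y \near x, `|dot (y - x) c| < e.
Proof.
move=> e0; set K := \sum_j `|c j 0|.
have K0 : 0 < 1 + K by rewrite ltr_pwDl // sumr_ge0.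
apply/nbhs_normP; exists (e / (1 + K)) => [|y]; first by rewrite /= divr_gt0.
rewrite /ball_ /= distrC ltr_pdivlMr // => yx; apply: le_lt_trans (dot_norm _ _) _.
by apply: le_lt_trans yx; rewrite ler_wpM2l // -/K lerDr.
Qed.

Lemma aff_hull_conv H x : aff_hull (conv a H) x ->
  exists2 tau : I -> R, \sum_(i in H) tau i = 1 & x = \sum_(i in H) tau i *: a i.
Proof.
move=> [m [p [l [/choice[mu Hmu] l1 ->]]]].
exists (fun i => \sum_j l j * mu j i).
  rewrite exchange_big /= -l1; apply: eq_bigr => j _.
  by rewrite -mulr_sumr; case: (Hmu j) => _ -> _; rewrite mulr1.
under [RHS]eq_bigr do rewrite scaler_suml.
rewrite exchange_big /=; apply: eq_bigr => j _.
case: (Hmu j) => _ _ {1}->; rewrite scaler_sumr; apply: eq_bigr => i _.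
by rewrite scalerA.
Qed.

(** A small displacement within the affine hull changes the coefficients of [x] by little, so they
    remain positive. *)
Lemma pos_comb_relint H x : pos_comb a H x -> relint (conv a H) x.
Proof.
move=> Hx; split; first exact: pos_comb_conv.
case: Hx => l [l0 l1 xl].
have [K HK] := span_coef H (fun i => a i - x).
(* The correction makes the coefficients sum to zero; it does not change the vector, since the
   [a i - x] weighted by [l i] cancel. *)
pose c i := K i - l i *: \sum_(j in H) K j.
have : \forall y \near x, forall i, i \in H -> `|dot (y - x) (c i)| < l i.
  apply: (@filter_forall _ I (fun i =>
    [set y | i \in H -> `|dot (y - x) (c i)| < l i]) (nbhs x)) => i.
  have [iH|iH] := boolP (i \in H); last first.
    by apply: nearW.
  by apply: filterS (near_dot x (c i) (l0 i iH)) => y /=.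
apply: filterS => y Hy /aff_hull_conv[tau tau1 ytau].
have {}HK := HK tau; rewrite /= sum_affine // -ytau in HK.
pose v := y - x; rewrite -/v in HK Hy.
have cE i : dot v (c i) = dot v (K i) - l i * \sum_(j in H) dot v (K j).
  by rewrite /c dotBr dotZr dot_sumr.
exists (fun i => l i + dot v (c i)); split.
- by move=> i /Hy; rewrite ltr_norml => /andP[+ _]; lra.
- rewrite big_split /= l1 (eq_bigr _ (fun i _ => cE i)) sumrB -mulr_suml l1.
  by rewrite mul1r subrr addr0.
- under eq_bigr do rewrite cE addrA scalerBl scalerDl.
  rewrite sumrB big_split /= -xl.
  under [X in _ - X]eq_bigr do rewrite mulrC -scalerA.
  rewrite -scaler_sumr -xl -addrA scaler_suml -sumrB.
  under eq_bigr do rewrite -scalerBr.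
  by rewrite -HK /v addrC subrK.
Qed.

Definition barycenter F : 'rV[R]_d := \sum_(i in F) #|F|%:R^-1 *: a i.

Lemma barycenter_pos F : F != finset.set0 -> pos_comb a F (barycenter F).
Proof.
rewrite -card_gt0 => F0; exists (fun=> #|F|%:R^-1); split => // [i _|].
  by rewrite invr_gt0 ltr0n.
by rewrite sumr_const -[LHS]mulr_natr mulVf // pnatr_eq0 -lt0n.
Qed.

Lemma conv_convex G x y (t : R) : 0 <= t -> t <= 1 -> conv a G x -> conv a G y ->
  conv a G (t *: x + (1 - t) *: y).
Proof.
move=> t0 t1 [l [l0 l1 ->]] [m [m0 m1 ->]].
exists (fun i => t * l i + (1 - t) * m i); split.
- by move=> i iG; rewrite addr_ge0 // mulr_ge0 ?l0 ?m0 ?subr_ge0.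
- by rewrite big_split /= -!mulr_sumr l1 m1 !mulr1 addrC subrK.
- under [RHS]eq_bigr do rewrite scalerDl -!scalerA.
  by rewrite big_split /= -!scaler_sumr.
Qed.

Lemma interior_segment (C : set 'rV[R]_d) y v : interior C y ->
  exists2 e : R, 0 < e & forall t, 0 <= t <= e -> C (y + t *: v).
Proof.
move=> /nbhs_normP[e /= e0 He]; have v0 : 0 < 1 + `|v| by rewrite ltr_pwDl.
exists (e / (1 + `|v|) / 2) => [|t /andP[t0 te]]; first by rewrite !divr_gt0.
apply: He; rewrite /ball_ /= opprD addrA subrr add0r normrN normrZ ger0_norm //.
have : t < e / (1 + `|v|).
  by rewrite (le_lt_trans te) // ltr_pdivrMr // ltr_pMr ?divr_gt0 // ltr1n.
rewrite ltr_pdivlMr // mulrDr mulr1; have : 0 <= t * `|v| by rewrite mulr_ge0.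
lra.
Qed.

(** Some [y] in [conv a F] is interior, and the barycenter is [s *: y + (1 - s) *: z] with [z] in
    [conv a F]. Moving the barycenter by [t *: v] amounts to moving [y] by [(t / s) *: v]. *)
Lemma barycenter_interior F v : F != finset.set0 ->
    ~ (conv a F `<=` boundary (conv a [set: I]%SET)) ->
  exists2 e : R, 0 < e &
    forall t, 0 <= t <= e -> conv a [set: I]%SET (barycenter F + t *: v).
Proof.
move=> F0 Fint.
have [y Fy yint] : exists2 y, conv a F y & interior (conv a [set: I]%SET) y.
  apply: contra_notP Fint => NF y Fy; split.
    by apply: subset_closure; apply: conv_sub Fy; apply: finset.subsetT.
  by move=> yint; apply: NF; exists y.
have [e e0 He] := interior_segment v yint.
have n1 : 1 <= #|F|%:R :> R by rewrite ler1n card_gt0.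
(* As each [l i] is at most 1, [s * l i] stays below the weight of the barycenter; the factor 1/2
   keeps [s] below 1 when [F] is a single label. *)
pose s : R := #|F|%:R^-1 / 2.
have s0 : 0 < s by rewrite divr_gt0 // invr_gt0; lra.
have s12 : s <= 1 / 2 by rewrite ler_wpM2r // ?invf_le1 //; lra.
case: (Fy) => l [l0 l1 yl].
have Fz : conv a F ((1 - s)^-1 *: (barycenter F - s *: y)).
  exists (fun i => (1 - s)^-1 * (#|F|%:R^-1 - s * l i)); split.
  - move=> i iF; rewrite mulr_ge0 ?invr_ge0 ?subr_ge0 //; first by lra.
    have : l i <= 1 by rewrite -l1 (bigD1 i) //= lerDl sumr_ge0 // => j /andP[/l0].
    move=> li1; have /le_trans -> // : s * l i <= s by rewrite ler_piMr // ltW.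
    by rewrite /s ler_pdivrMr // ler_peMr ?ler1n // invr_ge0 ler0n.
  - rewrite -mulr_sumr sumrB -mulr_sumr l1 mulr1 sumr_const.
    rewrite -[_^-1 *+ _]mulr_natr mulVf; last by rewrite gt_eqF //; lra.
    by rewrite mulVf // gt_eqF //; lra.
  - rewrite yl /barycenter [s *: _]scaler_sumr -sumrB scaler_sumr.
    by apply: eq_bigr => i _; rewrite -[RHS]scalerA scalerBl -[(s * _) *: _]scalerA.
exists (s * e) => [|t /andP[t0 te]]; first by rewrite mulr_gt0.
have -> : barycenter F + t *: v = s *: (y + (s^-1 * t) *: v) +
    (1 - s) *: ((1 - s)^-1 *: (barycenter F - s *: y)).
  rewrite [(1 - s) *: _]scalerA mulfV; last by rewrite gt_eqF //; lra.
  rewrite scale1r scalerDr scalerA mulrA mulfV ?gt_eqF // mul1r.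
  by rewrite [RHS]addrAC [s *: y + _]addrC subrK.
apply: conv_convex; [exact: ltW|lra| |].
  apply: He; rewrite mulr_ge0 ?invr_ge0 ?(ltW s0) //=.
  by rewrite mulrC ler_pdivrMr // mulrC.
by apply: conv_sub Fz; apply: finset.subsetT.
Qed.

End RelativeInterior.

(** * Cells of a subdivision identified by their relative interior points *)

Section Subdivision.
Variables (R : realType) (d : nat) (I : finType) (a : I -> 'rV[R]_d).
Variable Sigma : {set {set I}}.
Hypothesis Sigma_sub : subdivision a Sigma.
Implicit Types (F G H : {set I}) (x v : 'rV[R]_d) (c : 'cV[R]_d).

Lemma pos_comb_inj F G x : F \in Sigma -> G \in Sigma ->
  pos_comb a F x -> pos_comb a G x -> F = G.
Proof.
case: Sigma_sub => _ _ _ SD3 FS GS /pos_comb_relint Fx /pos_comb_relint Gx.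
apply/eqP/negPn/negP => /(SD3 _ _ FS GS) FG0.
by have : set0 x by rewrite -FG0.
Qed.

(** The carrier face of [x] in [G] is a cell by (SD1) and shares a relative interior point with [F],
    so it equals [F] by (SD3). *)
Lemma pos_comb_sub F G x : F \in Sigma -> G \in Sigma ->
  pos_comb a F x -> conv a G x -> F \subset G /\ config_face a G F.
Proof.
move=> FS GS Fx /carrier_face[H [GH HG Hx _]].
have HS : H \in Sigma by case: Sigma_sub => _ + _ _; apply; [exact: GS|].
by rewrite (pos_comb_inj FS HS Fx Hx).
Qed.

Lemma face_neq0 F : F \in Sigma -> F != finset.set0.
Proof.
move=> FS; case: Sigma_sub => /negP S0 _ _ _.
by apply/eqP => F0; rewrite -F0 in S0.
Qed.

Lemma sub_face F G : F \in Sigma -> G \in Sigma -> F \subset G -> config_face a G F.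
Proof.
move=> FS GS FG; have Fx := barycenter_pos a (face_neq0 FS).
by case: (pos_comb_sub FS GS Fx (conv_sub FG (pos_comb_conv Fx))).
Qed.

Lemma pos_eps (J : finType) (P : J -> R -> Prop) :
    (forall j, exists2 e, 0 < e & forall t, 0 < t <= e -> P j t) ->
  exists2 e, 0 < e & forall j t, 0 < t <= e -> P j t.
Proof.
move=> HP; have /choice[e He] j : exists e, 0 < e /\ forall t, 0 < t <= e -> P j t.
  by have [e e0 He] := HP j; exists e.
exists (\big[Num.min/1]_j e j).
  by apply: lt_bigmin => // j _; case: (He j).
move=> j t /andP[t0 te]; apply: (He j).2; rewrite t0 (le_trans te) //.
exact: bigmin_le.
Qed.

(** Gordan's theorem provides a functional positive on all [a i - x]; its least value [m] leaves
    room for a small displacement. *)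
Lemma conv_avoid G x v : ~ conv a G x ->
  exists2 e : R, 0 < e & forall t, 0 < t <= e -> ~ conv a G (x + t *: v).
Proof.
move=> NG; have [//|[c [_ cG]]|[mu mu0 [[t tG mut] Hmu]]] :=
  @gordan R d I G G (fun i => a i - x); last first.
  have [l [l0 l1 xl _]] := conv_of_relation mu0 tG mut Hmu.
  by case: NG; exists l.
pose m := \big[Num.min/1]_(i in G) dot (a i - x) c.
have m0 : 0 < m by apply: lt_bigmin => // i /cG.
have v0 : 0 < 1 + `|dot v c| by rewrite ltr_pwDl.
exists (m / (1 + `|dot v c|)) => [|t /andP[t0]]; first by rewrite divr_gt0.
rewrite ler_pdivlMr // => tm Gt.
have : m + dot x c <= dot (x + t *: v) c.
  apply: (conv_ge Gt) => i iG; rewrite -lerBrDr -dotBl.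
  exact: bigmin_le_cond.
rewrite dotDl dotZl addrC lerD2l => mt; have : t * dot v c <= t * `|dot v c|.
  by rewrite ler_pM2l // ler_norm.
lra.
Qed.

(** * The star of an interior face and the functionals separating its cells *)

Section Star.
Variable F : {set I}.
Hypothesis F_int : interior_face a Sigma F.

Let FS : F \in Sigma. Proof. by case: F_int. Qed.
Let x0 := barycenter a F.
Let p s := a s - x0.
Let Fx0 : pos_comb a F x0. Proof. exact/barycenter_pos/face_neq0. Qed.

Definition star : {set {set I}} :=
  [set G in maximal_faces Sigma | F \subset G]%SET.

Lemma starP G : G \in star -> [/\ G \in Sigma, F \subset G &
  forall H, H \in Sigma -> G \subset H -> H = G].
Proof.
by rewrite !inE => /andP[/maxsetP[GS maxG] FG]; split.
Qed.

Lemma star_antichain G G' : G \in star -> G' \in star -> G' != G ->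
  exists2 s, s \in G & s \notin G'.
Proof.
move=> /starP[GS _ maxG] /starP[G'S _ _] GG'; apply/fintype.subsetPn.
by apply: contra GG' => /(maxG _ G'S) ->.
Qed.

(** For small [t] the point [x0 + t *: v] lies in a cell. Cells missing [x0] also miss this point
    for small [t], so the cell contains [x0] and therefore [F]. Rescaling by [t^-1] gives cone
    coefficients. *)
Lemma star_cover v : exists2 G, G \in star &
  exists2 mu : I -> R, forall i, i \in G -> 0 <= mu i &
    v = \sum_(i in G) mu i *: p i.
Proof.
have [e e0 He] := barycenter_interior v (face_neq0 FS) (proj2 F_int).
have [e' e'0 He'] : exists2 e, 0 < e & forall G t, 0 < t <= e ->
    G \in Sigma -> conv a G (x0 + t *: v) -> F \subset G.
  apply: pos_eps => G; have [GS|GS] := boolP (G \in Sigma); last by exists 1.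
  have [Gx|/(conv_avoid v)[e1 e10 He1]] := pselect (conv a G x0).
    by exists 1 => // t _ _ _; have [] := pos_comb_sub FS GS Fx0 Gx.
  by exists e1 => // t /He1.
pose t := Num.min e e'; have t0 : 0 < t by rewrite lt_min e0.
have : conv a [set: I]%SET (x0 + t *: v) by apply: He; rewrite ltW //= ge_min lexx.
case: Sigma_sub => _ _ -> _ [G /= GS Gt].
have FG : F \subset G by apply: He' Gt => //; rewrite t0 ge_min lexx orbT.
have [G' maxG' GG'] := maxset_exists (P := [in Sigma]) GS.
exists G'; first by rewrite !inE maxG' (fintype.subset_trans FG).
have [l [l0 l1 xl]] := conv_sub GG' Gt.
exists (fun i => t^-1 * l i) => [i /l0 ?|]; first by rewrite mulr_ge0 // invr_ge0 ltW.
under eq_bigr do rewrite -scalerA.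
by rewrite -scaler_sumr sum_affine // -xl addrC addKr scalerA mulVf ?gt_eqF ?scale1r.
Qed.

(** The mass [e * m] is spread according to [mu]; the remaining [1 - e * m] goes to [F] in
    proportions that reproduce [x0]. *)
Lemma cone_comb G (mu : I -> R) e : F \subset G -> (forall i, 0 <= mu i) -> 0 < e ->
  e * \sum_(i in G) mu i <= 1 -> exists L : I -> R,
  [/\ forall i, i \in G -> 0 <= L i, \sum_(i in G) L i = 1,
      x0 + e *: \sum_(i in G) mu i *: p i = \sum_(i in G) L i *: a i
    & forall i, 0 < mu i -> 0 < L i].
Proof.
move=> FG mu0 e0; set m := \sum_(i in G) mu i => em.
case: Fx0 => l [l0 l1 xl].
have k0 i : 0 <= (1 - e * m) * (if i \in F then l i else 0).
  by rewrite mulr_ge0 ?subr_ge0 //; case: ifP => // /l0/ltW.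
exists (fun i => (1 - e * m) * (if i \in F then l i else 0) + e * mu i); split.
- by move=> i _; rewrite addr_ge0 // mulr_ge0 // ltW.
- by rewrite big_split /= -!mulr_sumr sum_supp // l1 mulr1 subrK.
- under [RHS]eq_bigr do rewrite scalerDl -!scalerA.
  rewrite big_split /= -!scaler_sumr sum_suppZ // -xl scalerBl scale1r.
  rewrite -addrA; congr (_ + _); rewrite /p; under eq_bigr do rewrite scalerBr.
  by rewrite sumrB -scaler_suml scalerBr scalerA addrC.
- by move=> i mui; rewrite ltr_wpDl // mulr_gt0.
Qed.

(** Scaled down, the common vector leads from [x0] to a point of both cells. The carrier face of
    this point in [G] contains all labels charged by [mu], and it lies in [G'] by [pos_comb_sub]. *)
Lemma star_support G G' (mu nu : I -> R) t : G \in star -> G' \in star ->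
    (forall i, 0 <= mu i) -> (forall i, 0 <= nu i) ->
    \sum_(i in G) mu i *: p i = \sum_(i in G') nu i *: p i ->
  t \in G -> 0 < mu t -> t \in G'.
Proof.
move=> /starP[GS FG _] /starP[G'S FG' _] mu0 nu0 munu tG mut.
set m := \sum_(i in G) mu i; set n := \sum_(i in G') nu i.
have m0 : 0 <= m by apply: sumr_ge0.
have n0 : 0 <= n by apply: sumr_ge0.
have mn0 : 0 < 1 + m + n by lra.
pose e := (1 + m + n)^-1.
have e0 : 0 < e by rewrite invr_gt0.
have [|L [L0 L1 xL Lt]] := @cone_comb G mu e FG mu0 e0.
  by rewrite /e mulrC ler_pdivrMr // mul1r -/m; lra.
have [|L' [L'0 L'1 xL' _]] := @cone_comb G' nu e FG' nu0 e0.
  by rewrite /e mulrC ler_pdivrMr // mul1r -/n; lra.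
rewrite munu in xL; set z := x0 + _ in xL xL'.
have /carrier_face[H [GH HG Hz HP]] : conv a G z by exists L.
have G'z : conv a G' z by exists L'.
have HS : H \in Sigma by case: Sigma_sub => _ + _ _; apply; [exact: GS|].
have [/fintype.subsetP + _] := pos_comb_sub HS G'S Hz G'z; apply.
by apply: (HP L) => //; apply: Lt.
Qed.

(** Gordan's theorem for the generators of [G] and the negated ones of [G']: a relation would equate
    a vector of one cone, charging a label outside [G'], with a vector of the other, against
    [star_support]. *)
Lemma star_separation G G' : G \in star -> G' \in star -> exists h : 'cV[R]_d,
  (forall s, s \in G -> 0 <= dot (p s) h) /\
  (forall s, s \in G' -> dot (p s) h <= 0) /\
  (forall s, s \in G -> s \notin G' -> 0 < dot (p s) h).
Proof.
move=> GM G'M.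
(* The sum type lets a label in both cells contribute [p s] and [- p s] separately. *)
pose S := [set x : I + I | match x with inl s => s \in G | inr s => s \in G' end]%SET.
pose T := [set x : I + I | match x with
  inl s => (s \in G) && (s \notin G') | inr s => false end]%SET.
pose q (x : I + I) := match x with inl s => p s | inr s => - p s end.
have [|[h [hS hT]]|[mu mu0 [[t tT mut] Hmu]]] := @gordan R d _ S T q.
- by apply/fintype.subsetP => -[s|s]; rewrite !inE // => /andP[].
- exists h; split => [s sG|]; first by apply: (hS (inl s)); rewrite inE.
  split => [s sG'|s sG sG'].
    by have := hS (inr s); rewrite inE dotNl oppr_ge0; apply.
  by apply: (hT (inl s)); rewrite inE sG.
exfalso; case: t tT mut => t; rewrite inE // => /andP[tG /negP tG'] mut; apply: tG'.
apply: (star_support GM G'M (mu := mu \o inl) (nu := mu \o inr)) => // [i|i|];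
  rewrite /= ?mu0 //.
move: Hmu; rewrite big_sumType /=.
under eq_bigl do rewrite inE; under [X in _ + X]eq_bigl do rewrite inE.
under [X in _ + X]eq_bigr do rewrite scalerN.
by rewrite sumrN => /subr0_eq.
Qed.

(** Antisymmetrizing the separators of ordered pairs preserves their signs and strictness. *)
Lemma star_separators : exists h : {set I} -> {set I} -> 'cV[R]_d,
  (forall G G', h G' G = - h G G') /\
  (forall G G' s, G \in star -> G' \in star -> s \in G ->
     0 <= dot (p s) (h G G') /\ (s \notin G' -> 0 < dot (p s) (h G G'))).
Proof.
have /choice[k Hk] (GG : {set I} * {set I}) : exists h : 'cV[R]_d,
  GG.1 \in star -> GG.2 \in star ->
  (forall s, s \in GG.1 -> 0 <= dot (p s) h) /\
  (forall s, s \in GG.2 -> dot (p s) h <= 0) /\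
  (forall s, s \in GG.1 -> s \notin GG.2 -> 0 < dot (p s) h).
  have [G1|] := boolP (GG.1 \in star); last by exists 0.
  have [G2|] := boolP (GG.2 \in star); last by exists 0.
  by have [h Hh] := star_separation G1 G2; exists h.
exists (fun G G' => k (G, G') - k (G', G)); split => [G G'|G G' s GM G'M sG].
  by rewrite opprB.
rewrite dotBr; have [/= k1 [k2 k3]] := Hk (G, G') GM G'M.
have [/= k1' [k2' k3']] := Hk (G', G) G'M GM.
have := k1 s sG; have := k2' s sG; split => [|/(k3 s sG)]; lra.
Qed.

End Star.
End Subdivision.

(** * Complete fans of simplicial type and their convex support functions *)

Section Fan.
Variables (R : realType) (d : nat) (T : finType) (M : {set T}).
Variable h : T -> T -> 'cV[R]_d.
Hypothesis h_anti : forall i j, h j i = - h i j.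

Let D i (v : 'rV[R]_d) := forall j, j \in M -> j != i -> 0 <= dot v (h i j).

Hypothesis D_cover : forall v, exists2 i, i \in M & D i v.
(** Linear independence of the walls of each cone, stated as freedom to prescribe their values. *)
Hypothesis h_surj : forall i, i \in M -> forall f : T -> R,
  exists y, forall j, j \in M -> j != i -> dot y (h i j) = f j.

Let dot_anti v i j : dot v (h j i) = - dot v (h i j).
Proof. by rewrite h_anti dotNr. Qed.

Let le0_perturb (x y : R) : (forall e, 0 < e -> 0 <= x + e * y) -> 0 <= x.
Proof.
move=> Hxy; rewrite leNgt; apply/negP => x0.
have y0 : 0 < 1 + `|y| by rewrite ltr_pwDl.
have := Hxy (- x / (1 + `|y|) / 2); rewrite !divr_gt0 ?oppr_gt0 // => /(_ isT).
have : - x / (1 + `|y|) / 2 * y <= - x / 2.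
  rewrite mulrAC ler_pM2r ?invr_gt0 // mulrAC ler_pdivrMr // ler_pM2l ?oppr_gt0 //.
  by have := ler_norm y; lra.
lra.
Qed.

(* A point pushed out of the cone [D i] through its wall [h i l = 0] can only
   land in [D l]. *)
Lemma wall_shared i l v : i \in M -> l \in M -> l != i -> D i v ->
  dot v (h i l) = 0 -> D l v.
Proof.
move=> iM lM li Div vil.
(* Near [v], the direction [y] violates only the wall [l] of [D i]. Any cone [D m] other than [D l]
   is excluded by antisymmetry, since [h i m] is positive there. *)
have [y Hy] := h_surj iM (fun m => if m == l then -1 else 1).
have Dl e : 0 < e -> D l (v + e *: y).
  move=> e0; have [m mM Dm] := D_cover (v + e *: y).
  have [<- //|ml] := eqVneq m l.
  have [mi|mi] := eqVneq m i.
    have := Dm l lM; rewrite mi li dotDl dotZl vil Hy // eqxx => /(_ isT).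
    lra.
  have := Dm i iM; rewrite eq_sym mi dot_anti dotDl dotZl Hy // (negPf ml).
  by move=> /(_ isT); have := Div m mM mi; lra.
move=> j jM jl; apply: (@le0_perturb _ (dot y (h l j))) => e e0.
by rewrite -dotZl -dotDl; apply: Dl.
Qed.

(** [r] lies on every wall of some [D j1] except the one facing [i0], so [wall_shared] carries it
    into all cones but [D i0]. On a wall of [D i0] it would enter [D i0] too, where [h i0 j1] is
    negative. *)
Lemma opposite_ray i0 : i0 \in M -> exists r, forall j, j \in M -> j != i0 ->
  D j r /\ dot r (h i0 j) < 0.
Proof.
move=> i0M; have [[j1 j1M j10]|NM] := pselect (exists2 j, j \in M & j != i0);
  last by exists 0 => j jM j0; case: NM; exists j.
have [r Hr] := h_surj j1M (fun m => (m == i0)%:R).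
have i01 : i0 != j1 by rewrite eq_sym.
have r1 : dot r (h i0 j1) = -1 by rewrite dot_anti Hr // eqxx.
have Dr1 : D j1 r by move=> j jM jj1; rewrite Hr.
exists r => j jM j0; have Dj : D j r.
  have [->//|jj1] := eqVneq j j1; apply: (@wall_shared j1) => //.
  by rewrite Hr // (negPf j0).
split=> //; rewrite ltNge; apply/negP => h0.
have Dr0 : D i0 r.
  apply: (@wall_shared j) => //; first by rewrite eq_sym.
  have i0j : i0 != j by rewrite eq_sym.
  by have := Dj i0 i0M i0j; rewrite dot_anti; lra.
by have := Dr0 j1 j1M j10; rewrite r1; lra.
Qed.

(* With [r] the ray opposite to the cone [D i0], the functionals vanishing on
   the walls of [D i0] and taking the value 1 at [r] are the linear pieces of
   a convex function whose domains of linearity are the cones [D i]. *)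
Lemma fan_support_functions : exists u : T -> 'cV[R]_d,
  forall i j v, i \in M -> j \in M -> D i v ->
    dot v (u j) <= dot v (u i) /\
    (j != i -> dot v (u j) = dot v (u i) -> dot v (h i j) = 0).
Proof.
have [i0 i0M _] := D_cover 0; have [r Hr] := opposite_ray i0M.
pose u j := if j == i0 then 0 else (dot r (h i0 j))^-1 *: h i0 j.
have u0 v : dot v (u i0) = 0 by rewrite /u eqxx dot0r.
have uE v j : j != i0 -> dot v (u j) = dot v (h i0 j) / dot r (h i0 j).
  by rewrite /u => /negPf ->; rewrite dotZr mulrC.
have ur j : j \in M -> j != i0 -> dot r (u j) = 1.
  by move=> jM j0; rewrite uE // divff // lt_eqF // (Hr j jM j0).2.
have u_h v j : j \in M -> j != i0 -> dot v (u j) = 0 -> dot v (h i0 j) = 0.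
  move=> jM j0 /eqP; rewrite uE // mulf_eq0 invr_eq0.
  by rewrite [X in _ || X]lt_eqF ?(Hr j jM j0).2 // orbF => /eqP.
have D0u v j : j \in M -> j != i0 -> D i0 v -> dot v (u j) <= 0.
  move=> jM j0 D0; rewrite uE // mulr_ge0_le0 ?D0 //.
  by rewrite invr_le0 ltW // (Hr j jM j0).2.
exists u => i j v iM jM Div.
have [ii0|ii0] := eqVneq i i0.
  move: Div; rewrite ii0 => D0; have [->|j0] := eqVneq j i0; first by rewrite lexx.
  by rewrite u0; split; [exact: D0u|move=> _ /(u_h _ _ jM j0)].
have [Dir hir] := Hr i iM ii0; have i0i : i0 != i by rewrite eq_sym.
(* Sliding [v] along [r] reaches the wall between [D i] and [D i0]. The other walls of [D i] contain
   [r], so their values are unchanged, and the comparison reduces to [D i0]. *)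
pose v' := v - dot v (u i) *: r.
have v'u m : m \in M -> m != i0 -> dot v' (u m) = dot v (u m) - dot v (u i).
  by move=> mM m0; rewrite dotBl dotZl ur // mulr1.
have v'i : dot v' (h i i0) = 0.
  by rewrite dot_anti u_h ?oppr0 // v'u // subrr.
have v'h m : m \in M -> m != i -> m != i0 -> dot v' (h i m) = dot v (h i m).
  move=> mM mi m0; rewrite dotBl dotZl.
  have -> : dot r (h i m) = 0; last by rewrite mulr0 subr0.
  have [Dmr _] := Hr m mM m0; have im : i != m by rewrite eq_sym.
  by have := Dir m mM mi; have := Dmr i iM im; rewrite dot_anti; lra.
have Div' : D i v'.
  move=> m mM mi; have [->|m0] := eqVneq m i0; first by rewrite v'i.
  by rewrite v'h // Div.
have D0v' : D i0 v' by apply: (@wall_shared i).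
have [->|j0] := eqVneq j i0.
  rewrite u0; split => [|_ /esym/(u_h _ _ iM ii0)].
    rewrite uE // mulr_le0 ?invr_le0 ?(ltW hir) //.
    by have := Div i0 i0M i0i; rewrite dot_anti; lra.
  by move=> vi0; rewrite dot_anti vi0 oppr0.
have := D0u v' j jM j0 D0v'; rewrite v'u // subr_le0; split=> // ji uij.
(* Equality places [v'] on the wall of [D i0] facing [j], hence in both [D i] and [D j]. *)
have Djv' : D j v'.
  by apply: (@wall_shared i0) => //; apply: u_h => //; rewrite v'u // uij subrr.
have ij : i != j by rewrite eq_sym.
by have := Djv' i iM ij; rewrite (dot_anti v' i j) v'h //; have := Div j jM ji; lra.
Qed.

End Fan.

(** * Face functionals and independence by a dimension count *)

Lemma config_face_functional (R : realType) (d : nat) (I : finType)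
    (a : I -> 'rV[R]_d) (G F : {set I}) : config_face a G F ->
  exists (c : 'cV[R]_d) (b : R), (forall i, i \in G -> b <= dot (a i) c) /\
    (forall i, (i \in F) <-> (i \in G /\ dot (a i) c = b)).
Proof.
case=> [->|[c [b [[c0 bG _] FG]]]].
  (* The improper face is cut out by the zero functional. *)
  by exists 0, 0; split=> i; rewrite dot0r //; split=> [|[]].
by exists c, b; split=> // i /(conv_mem a)/bG.
Qed.

(** Rank-nullity for the joint evaluation map: its kernel lies in [V], so its rank is at least
    [d - \dim V], hence at least [#|A|]; the map is onto and all bounds are equalities. *)
Lemma dual_surj (R : realType) (d : nat) (T : finType) (A : {set T})
    (h : T -> 'cV[R]_d) (V : {vspace 'rV[R]_d}) : (#|A| + \dim V <= d)%N ->
    (forall v, (forall t, t \in A -> dot v (h t) = 0) -> v \in V) ->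
  (#|A| + \dim V = d)%N /\
  forall f : T -> R, exists y, forall t, t \in A -> dot y (h t) = f t.
Proof.
move=> AVd kerV; pose B := \matrix_(i < d, j < #|A|) h (enum_val j) i 0.
have BE v j : (v *m B) 0 j = dot v (h (enum_val j)).
  by rewrite /dot !mxE; apply: eq_bigr => i _; rewrite mxE.
pose phi := linfun (mulmxr B : 'rV[R]_d -> 'rV[R]_#|A|).
have kphi : (lker phi <= V)%VS.
  apply/subvP => v; rewrite memv_ker lfunE /= => /eqP vB; apply: kerV => t tA.
  by rewrite -(enum_rankK_in tA tA) -BE vB mxE.
have := limg_ker_dim phi fullv; rewrite capfv dimvf dim_matrix mul1r => dE.
have imle : (\dim (limg phi) <= #|A|)%N.
  by rewrite (leq_trans (dimvS (subvf _))) // dimvf dim_matrix mul1r.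
have kle := dimvS kphi.
have imA : \dim (limg phi) = #|A|.
  apply/eqP; rewrite eqn_leq imle /= -(leq_add2r (\dim V)).
  by rewrite (leq_trans AVd) // -[leqLHS]dE addnC leq_add2l.
split.
  apply/eqP; rewrite eqn_leq AVd /= -[leqLHS]dE imA addnC leq_add2l //.
move=> f; have : (\row_j f (enum_val j) : 'rV[R]_#|A|) \in limg phi.
  have -> : limg phi = fullv.
    by apply/eqP; rewrite eqEdim subvf /= imA dimvf dim_matrix mul1r.
  exact: memvf.
case/memv_imgP => y _; rewrite lfunE /= => fy; exists y => t tA.
by rewrite -(enum_rankK_in tA tA) -BE -fy mxE.
Qed.

(** * The lineality space of the fan at the barycenter *)

Section StarFan.
Variables (R : realType) (d : nat) (I : finType) (a : I -> 'rV[R]_d).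
Variables (Sigma : {set {set I}}) (F : {set I}).
Hypothesis Sigma_sub : subdivision a Sigma.
Hypothesis F_int : interior_face a Sigma F.

Let FS : F \in Sigma. Proof. by case: F_int. Qed.
Let x0 := barycenter a F.
Let p s := a s - x0.
Let Fx0 : pos_comb a F x0. Proof. exact/barycenter_pos/(face_neq0 Sigma_sub). Qed.
Local Notation M := (star Sigma F).

Let bounded_line (x y : R) : (forall t, 0 <= x + t * y) -> y = 0.
Proof.
move=> Hxy; apply/eqP/negPn/negP => y0; have := Hxy (- (x + 1) / y).
by rewrite mulfVK //; lra.
Qed.

Lemma exposing_functional G : G \in M -> exists c : 'cV[R]_d,
  forall s, s \in G -> if s \in F then dot (p s) c = 0 else 0 < dot (p s) c.
Proof.
move=> /starP[GS FG _].
have [c [b [bG Fb]]] := config_face_functional (sub_face Sigma_sub FS GS FG).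
have xb : dot x0 c = b.
  case: Fx0 => l [_ l1 ->]; rewrite dot_suml -[RHS]mul1r -l1 mulr_suml.
  by apply: eq_bigr => i /Fb[_ <-]; rewrite dotZl.
exists c => s sG; rewrite dotBl xb; case: ifPn => [/Fb[_ ->]|sF].
  by rewrite subrr.
rewrite subr_gt0 lt_neqAle bG // andbT; apply: contra sF => /eqP bs.
exact/Fb.
Qed.

Variable h : {set I} -> {set I} -> 'cV[R]_d.
Hypothesis h_anti : forall G G', h G' G = - h G G'.
Hypothesis h_sep : forall G G' s, G \in M -> G' \in M -> s \in G ->
  0 <= dot (p s) (h G G') /\ (s \notin G' -> 0 < dot (p s) (h G G')).

Lemma star_chamber G v (mu : I -> R) G' : G \in M -> G' \in M ->
    (forall i, i \in G -> 0 <= mu i) -> v = \sum_(i in G) mu i *: p i ->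
  0 <= dot v (h G G').
Proof.
move=> GM G'M mu0 ->; rewrite dot_suml sumr_ge0 // => i iG.
by rewrite dotZl mulr_ge0 ?mu0 //; case: (h_sep GM G'M iG).
Qed.

(* A line parallel to [v] through an interior point of the cone of [G] stays in
   that cone, so [v] is killed by the functionals exposing [F] in [G]; these
   form an open set among those vanishing on [F]. *)
Lemma star_kernel G v c : G \in M ->
    (forall G', G' \in M -> G' != G -> dot v (h G G') = 0) ->
  (forall s, s \in F -> dot (p s) c = 0) -> dot v c = 0.
Proof.
move=> GM vh cF; have [c1 Hc1] := exposing_functional GM.
pose v0 := \sum_(s in G) p s.
have line c' : (forall s, s \in G -> 0 <= dot (p s) c') -> dot v c' = 0.
  move=> Hc'; apply: (@bounded_line (dot v0 c')) => t; rewrite -dotZl -dotDl.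
  have [G' G'M [mu mu0 vmu]] := star_cover Sigma_sub F_int (v0 + t *: v).
  suff G'G : G' = G.
    rewrite vmu dot_suml sumr_ge0 // => i iG'; rewrite dotZl mulr_ge0 ?mu0 //.
    by apply: Hc'; rewrite -G'G.
  apply/eqP/negPn/negP => G'G.
  have := star_chamber G'M GM mu0 vmu.
  rewrite h_anti dotNr dotDl dotZl vh // mulr0 addr0 oppr_ge0 leNgt => /negP; apply.
  (* A label of [G] outside [G'] makes [h G G'] strictly positive on the whole line through [v0],
     which therefore misses the cone of [G']. *)
  have [s sG sG'] := star_antichain GM G'M G'G.
  rewrite dot_suml (bigD1 s) //= ltr_pwDl //.
    by case: (h_sep GM G'M sG) => _; apply.
  by apply: sumr_ge0 => i /andP[iG _]; case: (h_sep GM G'M iG).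
have [e e0 He] : exists2 e, 0 < e & forall s t, 0 < t <= e -> s \in G ->
    0 <= dot (p s) (c1 + t *: c).
  apply: pos_eps => s; have [sG|] := boolP (s \in G); last by exists 1.
  have := Hc1 s sG; case: ifPn => [sF cs|sF cs].
    by exists 1 => // t _ _; rewrite dotDr dotZr cs cF // mulr0 addr0.
  have n0 : 0 < 1 + `|dot (p s) c| by rewrite ltr_pwDl.
  exists (dot (p s) c1 / (1 + `|dot (p s) c|)) => [|t /andP[t0]].
    by rewrite divr_gt0.
  rewrite ler_pdivlMr // dotDr dotZr mulrDr mulr1 => tc _.
  have : t * - dot (p s) c <= t * `|dot (p s) c|.
    by rewrite ler_pM2l // -normrN ler_norm.
  lra.
have v1 : dot v c1 = 0.
  by apply: line => s sG; have := Hc1 s sG; case: ifP => _; [move=> ->|move=> /ltW].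
have : dot v (c1 + e *: c) = 0 by apply: line => s; apply: He; rewrite e0 /=.
by rewrite dotDr dotZr v1 add0r => /eqP; rewrite mulf_eq0 gt_eqF //= => /eqP.
Qed.

Let V := <<[seq a i - a j | i <- enum F, j <- enum F]>>%VS.

(** The coordinates of the projection [f] along [V] are functionals vanishing on all [p s] with [s]
    in [F]; [star_kernel] then gives [f v = 0]. *)
Lemma star_kernel_span G v : G \in M ->
  (forall G', G' \in M :\ G -> dot v (h G G') = 0) -> v \in V.
Proof.
move=> GM vh; pose f := (\1 - projv V)%VF.
have fE w j : dot w (col j (lin1_mx f)) = f w 0 j.
  rewrite -mul_rV_lin1 /dot !mxE; apply: eq_bigr => i _.
  by rewrite mxE.
have pV s : s \in F -> p s \in V.
  move=> sF; case: Fx0 => l [_ l1 xl].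
  have -> : p s = \sum_(i in F) l i *: (a s - a i).
    under eq_bigr do rewrite scalerBr.
    by rewrite sumrB -scaler_suml l1 scale1r -xl.
  apply: memv_suml => i iF; apply/memvZ/memv_span/allpairsP.
  by exists (s, i); rewrite !mem_enum.
have fv : f v = 0.
  apply/rowP => j; rewrite -fE mxE; apply: (star_kernel GM) => [G' G'M G'G|s sF].
    by apply: vh; rewrite in_setD1 G'G.
  by rewrite fE !lfunE /= !lfunE /= projv_id ?pV // subrr mxE.
move: fv; rewrite !lfunE /= !lfunE /= => /eqP; rewrite subr_eq0 => /eqP ->.
exact: memv_proj.
Qed.

End StarFan.

(** * Counting the maximal cells and transferring the support functions *)

Section SupportFunctions.
Variables (R : realType) (d : nat) (I : finType) (a : I -> 'rV[R]_d).
Variables (Sigma : {set {set I}}) (F : {set I}) (k : nat).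
Hypothesis Sigma_sub : subdivision a Sigma.
Hypothesis F_int : interior_face a Sigma F.
Hypothesis card_max : #|maximal_faces Sigma| = k.
Hypothesis dim_F : (dim_conv a F + (k - 1) = d)%N.

(** A cell of the star has at most [k - 1] walls, whose common kernel lies in a space of dimension
    [d - (k - 1)]. So [dual_surj] applies: it makes the walls independent and shows that the star
    has [k] cells. *)
Lemma maximal_support_functions : exists u : {set I} -> 'cV[R]_d,
  forall G G' i, G \in maximal_faces Sigma -> G' \in maximal_faces Sigma ->
    i \in G ->
    dot (a i - barycenter a F) (u G') <= dot (a i - barycenter a F) (u G) /\
    (dot (a i - barycenter a F) (u G') = dot (a i - barycenter a F) (u G) ->
     i \in G').
Proof.
pose M := star Sigma F.
have [h [h_anti h_sep]] := star_separators Sigma_sub F_int.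
have subM : M \subset maximal_faces Sigma.
  by apply/fintype.subsetP => G; rewrite [G \in M]inE => /andP[].
have Hsurj G : G \in M -> (#|M :\ G| + dim_conv a F = d)%N /\
    forall f : {set I} -> R, exists y, forall t, t \in M :\ G -> dot y (h G t) = f t.
  move=> GM; apply: dual_surj; last first.
    by move=> v; apply: (star_kernel_span Sigma_sub F_int h_anti h_sep GM).
  rewrite -[leqRHS]dim_F addnC leq_add2l -card_max.
  have := subset_leq_card subM; rewrite (cardsD1 G) GM; lia.
have [G0 G0M _] := star_cover Sigma_sub F_int 0.
have ME : maximal_faces Sigma = M.
  apply/esym/eqP; rewrite eqEcard subM /=.
  have [+ _] := Hsurj G0 G0M; rewrite (cardsD1 G0 M) G0M card_max -[in RHS]dim_F.
  lia.
have [||u Hu] := @fan_support_functions R d _ M h h_anti.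
- move=> v; have [G GM [mu mu0 vmu]] := star_cover Sigma_sub F_int v.
  by exists G => // G' G'M _; apply: (star_chamber h_sep GM G'M mu0 vmu).
- move=> G GM f; have [_ /(_ f)[y Hy]] := Hsurj G GM.
  by exists y => G' G'M G'G; apply: Hy; rewrite in_setD1 G'G.
exists u => G G' i; rewrite ME => GM G'M iG.
have [|uGG' uh] := Hu G G' (a i - barycenter a F) GM G'M.
  by move=> G1 G1M _; case: (h_sep _ _ _ GM G1M iG).
split=> // /uh hi; have [->//|GG'] := eqVneq G' G.
apply/negPn/negP => iG'; have [_ /(_ iG')] := h_sep _ _ _ GM G'M iG.
by rewrite hi ?ltxx.
Qed.

End SupportFunctions.

(** * Lower faces of the lifted polyhedron as sets of minimizers *)

(** For nonempty [G] the number [b] is the minimum, attained exactly on [G]; for empty [G] it is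
    only a strict lower bound, so nonemptiness is stated separately. *)
Definition argmin (R : realType) (d : nat) (I : finType) (a : I -> 'rV[R]_d)
    (w : I -> R) (G : {set I}) (c : 'cV[R]_d) (b : R) :=
  forall i, b <= w i + dot (a i) c /\ ((i \in G) <-> w i + dot (a i) c = b).

Section LowerFaces.
Variables (R : realType) (d : nat) (I : finType) (a : I -> 'rV[R]_d).
Variable w : I -> R.
Implicit Types (G : {set I}) (P : set 'rV[R]_(1 + d)).

Let up : 'rV[R]_(1 + d) := row_mx 1%:M 0.

Lemma conv_norm_le n (q : I -> 'rV[R]_n) G x : conv q G x ->
  `|x| <= \sum_(i in G) `|q i|.
Proof.
move=> [l [l0 l1 ->]]; apply: le_trans (ler_norm_sum _ _ _) _.
apply: ler_sum => i iG; rewrite normrZ ger0_norm ?l0 // ler_piMl //.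
by rewrite -l1 (bigD1 i) //= lerDl sumr_ge0 // => j /andP[/l0].
Qed.

Lemma dot_lift i (c : 'cV[R]_(1 + d)) :
  dot (lift_point a w i) c = w i * dot up c + dot (a i) (dsubmx c).
Proof.
rewrite -[c]vsubmxK /lift_point /up /dot !mul_row_col mul0mx addr0 mul1mx col_mxKd.
by rewrite mul_scalar_mx !mxE.
Qed.

Lemma ray_unbounded P z : bounded_set P -> ~ (forall t, 0 <= t -> P (z + t *: up)).
Proof.
move=> [K [_ HK]] Pz.
pose t := `|K| + 2 + `|z 0 (lshift d 0)|.
have t0 : 0 <= t by rewrite !addr_ge0.
have : `|z + t *: up| <= K + 1 by apply: HK (Pz _ t0); rewrite ltrDl.
have := mx_entry_le_norm (z + t *: up) 0 (lshift d 0).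
rewrite [in X in X <= _]mxE [X in _ + X]mxE row_mxEl mxE eqxx mulr1.
have := ler_norm (z 0 (lshift d 0) + t); have := ler_norm K.
have := ler_norm (- z 0 (lshift d 0)); rewrite normrN /t.
lra.
Qed.

Lemma lift_in_polyhedron i : lifted_polyhedron a w (lift_point a w i).
Proof.
exists (lift_point a w i), 0; split=> //; last by rewrite scale0r addr0.
exact/conv_mem/finset.in_setT.
Qed.

(** A bounded face contains no upward ray, so its normal has positive height and can be scaled to
    height 1. Conversely, a normal of height 1 selects only points with [t = 0], which form a
    bounded set. *)
Lemma lower_face_argmin G : (0 < #|I|)%N ->
  (exists2 P, lower_face a w P & forall i, (i \in G) <-> P (lift_point a w i)) <->
  G != finset.set0 /\ exists (c : 'cV[R]_d) (b : R), argmin a w G c b.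
Proof.
move=> /card_gt0P[i0 _]; split.
  move=> [P [Pface Pbd] GP]; case: Pface => [Pall|[c [b [[c0 bP [x [Px xb]]] PE]]]].
    case: (ray_unbounded (z := lift_point a w i0) Pbd) => t t0.
    rewrite Pall; exists (lift_point a w i0), t; split=> //.
    exact/conv_mem/finset.in_setT.
  have up_ge t : 0 <= t -> lifted_polyhedron a w (x + t *: up).
    move=> t0; case: Px => y [t' [Hy t'0 ->]]; exists y, (t' + t).
    by split=> //; [rewrite addr_ge0|rewrite scalerDl addrA].
  have xb' : dot x c = b := xb.
  have up0 : 0 <= dot up c.
    by have := bP _ (up_ge 1 ler01); rewrite dotE dotDl dotZl xb'; lra.
  have {}up0 : 0 < dot up c.
    rewrite lt_neqAle up0 andbT; apply/eqP => up0'.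
    apply: (ray_unbounded (z := x) Pbd) => t t0; rewrite PE; split; first exact: up_ge.
    by rewrite /hyperplane /= dotE dotDl dotZl xb' -up0' mulr0 addr0.
  have bi i : b <= dot (lift_point a w i) c by apply/bP/lift_in_polyhedron.
  have Gb i : (i \in G) <-> dot (lift_point a w i) c = b.
    rewrite GP PE; split=> [[]//|ib]; split=> //; exact: lift_in_polyhedron.
  have scale i : w i + dot (a i) ((dot up c)^-1 *: dsubmx c) =
      dot (lift_point a w i) c / dot up c.
    by rewrite dot_lift dotZr mulrDl mulfK ?gt_eqF // [_^-1 * _]mulrC.
  split; last first.
    exists ((dot up c)^-1 *: dsubmx c), (b / dot up c) => i; rewrite scale.
    split; first by rewrite ler_pM2r ?invr_gt0.
    rewrite Gb; split=> [->//|/mulIf]; apply.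
    by rewrite invr_eq0 gt_eqF.
  (* If no lifted point were on the hyperplane, the convex combination below [x] would have only
     zero coefficients. *)
  apply/eqP => G0; case: Px xb' => y [t [[l [l0 l1 yl] t0 xy]]] xb'.
  have sum0 : \sum_(i in [set: I]%SET) l i * (dot (lift_point a w i) c - b) = 0.
    apply/eqP; rewrite eq_le sumr_ge0 ?andbT; last first.
      by move=> i iI; rewrite mulr_ge0 ?l0 // subr_ge0.
    under eq_bigr do rewrite mulrBr -dotZl.
    rewrite sumrB -mulr_suml l1 mul1r -dot_suml -yl -xb' xy dotDl dotZl.
    by rewrite opprD addrA subrr sub0r oppr_le0 mulr_ge0 // ltW.
  have /psumr_eq0P/(_ sum0) l_eq0 : forall i, i \in [set: I]%SET ->
      0 <= l i * (dot (lift_point a w i) c - b).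
    by move=> i iI; rewrite mulr_ge0 ?l0 // subr_ge0.
  suff : \sum_(i in [set: I]%SET) l i = 0 by rewrite l1 => /eqP; rewrite oner_eq0.
  apply: big1 => i iI; have /eqP := l_eq0 i iI; rewrite mulf_eq0 => /orP[/eqP//|].
  by rewrite subr_eq0 => /eqP/Gb; rewrite G0 inE.
move=> [/finset.set0Pn[i iG] [c [b Hcb]]].
pose c' : 'cV[R]_(1 + d) := col_mx 1%:M c.
have upc : dot up c' = 1.
  by rewrite /dot /up mul_row_col mul1mx mul0mx addr0 mxE eqxx.
have liftc j : dot (lift_point a w j) c' = w j + dot (a j) c.
  by rewrite dot_lift upc mulr1 col_mxKd.
have convc y : conv (lift_point a w) [set: I]%SET y -> b <= dot y c'.
  by move=> Hy; apply: (conv_ge Hy) => j _; rewrite liftc; case: (Hcb j).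
exists (lifted_polyhedron a w `&` hyperplane c' b); last first.
  move=> j; rewrite (Hcb j).2 -liftc; split=> [jb|[]//].
  by split=> //; apply: lift_in_polyhedron.
split.
  right; exists c', b; split=> //; split.
  - by apply/eqP => c'0; have /eqP := upc; rewrite c'0 dot0r eq_sym oner_eq0.
  - move=> _ [y [t [Hy t0 ->]]]; rewrite dotE dotDl dotZl upc mulr1.
    by have := convc y Hy; lra.
  - exists (lift_point a w i); split; first exact: lift_in_polyhedron.
    by rewrite /hyperplane /= dotE liftc; apply/(Hcb i).2.
exists (\sum_(j in [set: I]%SET) `|lift_point a w j|); split; first exact: num_real.
move=> K HK x [[y [t [Hy t0 ->]]]].
rewrite /hyperplane /= dotE dotDl dotZl upc mulr1 => tb.
have -> : t = 0 by have := convc y Hy; lra.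
by rewrite scale0r addr0 (le_trans (conv_norm_le Hy)) // ltW.
Qed.

(* Both minimal faces compute the lower envelope of the lifted points at [x]. *)
Lemma argmin_sub G1 G2 x c1 b1 c2 b2 : pos_comb a G1 x -> pos_comb a G2 x ->
  argmin a w G1 c1 b1 -> argmin a w G2 c2 b2 -> G1 \subset G2.
Proof.
move=> [l1 [l10 l11 xl1]] [l2 [l20 l21 xl2]] min1 min2.
pose W (G : {set I}) (l : I -> R) := \sum_(i in G) l i * w i.
have WE G l c b : \sum_(i in G) l i = 1 -> x = \sum_(i in G) l i *: a i ->
    \sum_(i in G) l i * (w i + dot (a i) c - b) = W G l + dot x c - b.
  move=> lG xl; under eq_bigr do rewrite mulrBr mulrDr -dotZl.
  by rewrite sumrB big_split /= -dot_suml -xl -mulr_suml lG mul1r.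
have ge0 G l c b G' : (forall i, i \in G -> 0 < l i) -> argmin a w G' c b ->
    forall i, i \in G -> 0 <= l i * (w i + dot (a i) c - b).
  move=> l0 minG i iG; rewrite mulr_ge0 ?subr_ge0 ?(ltW (l0 i iG)) //.
  by case: (minG i).
have eq0 G l c b : argmin a w G c b ->
    \sum_(i in G) l i * (w i + dot (a i) c - b) = 0.
  by move=> minG; apply: big1 => i /(minG i).2 ->; rewrite subrr mulr0.
(* Each combination is exact for its own supporting function and bounded below by the other, so both
   have the same height. *)
have W12 : W G1 l1 + dot x c2 - b2 = 0.
  have := eq0 _ l1 _ _ min1; have := eq0 _ l2 _ _ min2.
  have := sumr_ge0 (index_enum I) (ge0 _ _ _ _ _ l20 min1).
  have := sumr_ge0 (index_enum I) (ge0 _ _ _ _ _ l10 min2).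
  by rewrite !WE //; lra.
apply/fintype.subsetP => i iG1; apply/(min2 i).2.
have := psumr_eq0P (ge0 _ _ _ _ _ l10 min2); rewrite WE // => /(_ W12 i iG1)/eqP.
by rewrite mulf_eq0 gt_eqF ?l10 //= subr_eq0 => /eqP.
Qed.

End LowerFaces.

(** * Weights that induce the subdivision *)

(** A maximal cell minimizes [w] minus its linear piece; a smaller cell is singled out by adding a
    small multiple of a functional exposing it. Conversely, the barycenter of a minimizing set is a
    relative interior point of some cell, and [argmin_sub] in both directions identifies the two. *)
Lemma regular_of_support_functions (R : realType) (d : nat) (I : finType)
    (a : I -> 'rV[R]_d) (Sigma : {set {set I}}) (x0 : 'rV[R]_d)
    (u : {set I} -> 'cV[R]_d) : (0 < #|I|)%N -> subdivision a Sigma ->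
    (forall G G' i, G \in maximal_faces Sigma -> G' \in maximal_faces Sigma ->
      i \in G -> dot (a i - x0) (u G') <= dot (a i - x0) (u G) /\
      (dot (a i - x0) (u G') = dot (a i - x0) (u G) -> i \in G')) ->
  regular_subdivision a Sigma.
Proof.
set M := maximal_faces Sigma => I0 Sigma_sub Hu.
pose g i G := dot (a i - x0) (u G).
(* Points that are used by no cell only have to lie above the convex function
   with linear pieces [u G]. *)
pose w i := if [pick G in M | i \in G] is Some G then g i G
            else 1 + \sum_(G in M) `|g i G|.
have wG i G : G \in M -> g i G <= w i /\ ((i \in G) <-> w i = g i G).
  move=> GM; rewrite /w; case: pickP => [G' /andP[G'M iG']|NG].
    have [leG eqG] := Hu G' G i G'M GM iG'; split=> //; split=> [iG|/esym//].
    by apply: le_anti; rewrite leG andbT; case: (Hu G G' i GM G'M iG).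
  have lt : g i G < 1 + \sum_(G in M) `|g i G|.
    rewrite (le_lt_trans (ler_norm _)) // (bigD1 G GM) /=.
    have : 0 <= \sum_(G' in M | G' != G) `|g i G'| by apply: sumr_ge0.
    lra.
  split; first exact: ltW.
  split=> [iG|]; first by have := NG G; rewrite /= GM iG.
  by move=> eqg; move: lt; rewrite eqg ltxx.
have argminS G : G \in Sigma -> exists (c : 'cV[R]_d) (b : R), argmin a w G c b.
  move=> GS; have [G' maxG' GG'] := maxset_exists (P := [in Sigma]) GS.
  have G'M : G' \in M by rewrite inE.
  have G'S : G' \in Sigma by case/maxsetP: maxG'.
  have [c [b [bG' Gb]]] := config_face_functional (sub_face Sigma_sub GS G'S GG').
  (* Outside [G'] the gap [w i - g i G'] is positive and absorbs the perturbation. *)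
  have [e e0 He] : exists2 e, 0 < e & forall i t, 0 < t <= e -> i \notin G' ->
      0 < w i - g i G' + t * (dot (a i) c - b).
    apply: pos_eps => i; have [iG'|iG'] := boolP (i \in G'); first by exists 1.
    have [wge weq] := wG i G' G'M; set z := dot (a i) c - b.
    have n0 : 0 < 1 + `|z| by rewrite ltr_pwDl.
    have w0 : 0 < w i - g i G'.
      rewrite subr_gt0 lt_neqAle wge andbT eq_sym; apply: contra iG' => /eqP.
      by move=> /weq.
    exists ((w i - g i G') / (1 + `|z|)) => [|t /andP[t0]]; first by rewrite divr_gt0.
    rewrite ler_pdivlMr // => tw _.
    have : t * - z <= t * `|z| by rewrite ler_pM2l // -normrN ler_norm.
    lra.
  (* The constant undoes the translation by [x0] and shifts the minimum of the perturbation to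
     zero. *)
  exists (- u G' + e *: c), (e * b - dot x0 (u G')) => i.
  have -> : w i + dot (a i) (- u G' + e *: c) =
      (w i - g i G' + e * (dot (a i) c - b)) + (e * b - dot x0 (u G')).
    by rewrite dotDr dotNr dotZr /g dotBl; ring.
  set s := w i - _ + _; have [s0 sE] : 0 <= s /\ ((i \in G) <-> s = 0).
    have [iG'|iG'] := boolP (i \in G').
      have -> : s = e * (dot (a i) c - b).
        by rewrite /s ((wG i G' G'M).2.1 iG') subrr add0r.
      split; first by rewrite mulr_ge0 ?(ltW e0) // subr_ge0 bG'.
      rewrite Gb; split=> [[_ ->]|/eqP]; first by rewrite subrr mulr0.
      by rewrite mulf_eq0 gt_eqF //= subr_eq0 => /eqP.
    have s0 : 0 < s by apply: He => //; rewrite e0 /=.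
    split; first exact: ltW.
    split=> [iG|s0']; first by case/negP: iG'; apply: (fintype.subsetP GG').
    by rewrite s0' ltxx in s0.
  split; first by rewrite lerDr.
  rewrite sE; split=> [->|/eqP]; first by rewrite add0r.
  by rewrite -subr_eq0 addrK => /eqP.
exists w => G; rewrite lower_face_argmin //; split=> [GS|[G0 [c [b Hcb]]]].
  by split; [exact: (face_neq0 Sigma_sub)|apply: argminS].
have Gx := barycenter_pos a G0; set x := barycenter a G in Gx.
have [F FS Fx] : exists2 F, F \in Sigma & conv a F x.
  have : conv a [set: I]%SET x.
    by apply: conv_sub (pos_comb_conv Gx); apply: finset.subsetT.
  by case: Sigma_sub => _ _ -> _ [F /= FS Fx]; exists F.
have [H [FH _ Hx _]] := carrier_face Fx.
have HS : H \in Sigma by case: Sigma_sub => _ + _ _; apply; [exact: FS|].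
suff -> : G = H by [].
have [c' [b' Hcb']] := argminS H HS.
apply/eqP; rewrite finset.eqEsubset.
by rewrite (argmin_sub Gx Hx Hcb Hcb') (argmin_sub Hx Gx Hcb' Hcb).
Qed.

Theorem theorem4p9 (R : realType) (d : nat) (I : finType) (a : I -> 'rV[R]_d)
    (k : nat) (Sigma : {set {set I}}) :
  point_configuration a -> (1 <= k)%N -> ksplit a k Sigma ->
    regular_subdivision a Sigma.
Proof.
move=> _ _ [[Sigma_sub _ _] card_max [F F_int dim_F]].
have [u Hu] := maximal_support_functions Sigma_sub F_int card_max dim_F.
apply: (regular_of_support_functions _ Sigma_sub Hu).
have /finset.set0Pn[i _] := face_neq0 Sigma_sub (proj1 F_int).
by apply/card_gt0P; exists i.
Qed.
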